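(* Let $\mathcal{F}$ be a system of subsets of $[n]$. Then $\chi\big(\mathrm{KG}^2(\mathcal{F}_{\widetilde{2\text{-stab}}})\big) \ge \mathrm{cd}^2(\mathcal{F})$.
   Context: For a system $\mathcal{G}$ of subsets of $[n]=\{1,\dots,n\}$, $\mathrm{KG}^2(\mathcal{G})$ is the graph with vertex set $\mathcal{G}$ and an edge between any two disjoint sets of $\mathcal{G}$; $\chi$ denotes its chromatic number (least number of colors so that no edge is monochromatic). The $2$-colorability defect is $$\mathrm{cd}^2(\mathcal{F}) = n - \max\{|A_1|+|A_2| : A_1,A_2\subset[n] \text{ disjoint, and } F\not\subset A_i \text{ for all } F\in\mathcal{F},\ i\in\{1,2\}\}.$$ A set $\sigma\subset[n]$ is almost $2$-stable if $|i-j|\ne 1$ for all $i,j\in\sigma$ (it may contain both $1$ and $n$); $\mathcal{F}_{\widetilde{2\text{-stab}}}$ is the subsystem of almost $2$-stable sets of $\mathcal{F}$. *)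

(* Defs.v *)
From mathcomp Require Import all_boot all_order ssralg ssrint.
Set Implicit Arguments.
Unset Strict Implicit.
Unset Printing Implicit Defensive.

Record sgraph := SGraph {
  vertex :> finType;
  edge : rel vertex;
  edge_sym : symmetric edge;
  edge_irrefl : irreflexive edge
}.

Definition colorable (G : sgraph) (k : nat) : bool :=
  [exists c : {ffun G -> 'I_k},
    [forall x : G, [forall y : G, edge x y ==> (c x != c y)]]].

Lemma ex_colorable (G : sgraph) : exists k, colorable G k.
Proof.
exists #|G|; apply/existsP; exists [ffun x => enum_rank x].
apply/forallP=> x; apply/forallP=> y; apply/implyP=> exy; rewrite !ffunE.
apply/eqP=> /enum_rank_inj eq_xy.
by move: exy; rewrite eq_xy edge_irrefl.
Qed.

Definition chromatic_number (G : sgraph) : nat := ex_minn (ex_colorable G).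

(* The ground set {1, ..., n} is 'I_n; only differences of elements matter, *)
(* so the shift to {0, ..., n - 1} is harmless.                             *)

(* A loop at the empty set, which is disjoint from itself, is excluded by   *)
(* A != B; for nonempty sets this condition is implied by disjointness.     *)
Definition kneser_edge (n : nat) (G : {set {set 'I_n}}) :
    rel {A : {set 'I_n} | A \in G} :=
  fun A B => (A != B) && [disjoint val A & val B].

Lemma kneser_edge_sym (n : nat) (G : {set {set 'I_n}}) :
  symmetric (@kneser_edge n G).
Proof. by move=> A B; rewrite /kneser_edge eq_sym disjoint_sym. Qed.

Lemma kneser_edge_irrefl (n : nat) (G : {set {set 'I_n}}) :
  irreflexive (@kneser_edge n G).
Proof. by move=> A; rewrite /kneser_edge eqxx. Qed.

Definition KG2 (n : nat) (G : {set {set 'I_n}}) : sgraph :=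
  SGraph (@kneser_edge_sym n G) (@kneser_edge_irrefl n G).

Definition admissible_pair (n : nat) (F : {set {set 'I_n}})
    (A : {set 'I_n} * {set 'I_n}) : bool :=
  [disjoint A.1 & A.2] &&
  [forall B in F, ~~ (B \subset A.1) && ~~ (B \subset A.2)].

(* The maximum in cd2 is over a nonempty family exactly when F does not     *)
(* contain the empty set.                                                   *)
Lemma ex_admissible_pair (n : nat) (F : {set {set 'I_n}}) :
  (exists A, admissible_pair F A) <-> set0 \notin F.
Proof.
split=> [[A /andP[_ /forall_inP FA]] | F0].
  by apply/negP=> /FA; rewrite !sub0set.
exists (set0, set0); apply/andP; split; first by rewrite disjoints_subset sub0set.
apply/forall_inP=> B FB; rewrite /= subset0 andbb.
by apply: contraNneq F0 => <-.
Qed.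

Lemma admissible_pair_card (n : nat) (F : {set {set 'I_n}}) A :
  admissible_pair F A -> #|A.1| + #|A.2| <= n.
Proof.
case/andP=> dA _; rewrite -cardsUI.
move: dA; rewrite -setI_eq0 => /eqP ->; rewrite cards0 addn0.
by rewrite -[leqRHS]card_ord max_card.
Qed.

(* The subtraction does not truncate, by admissible_pair_card.              *)
Definition cd2 (n : nat) (F : {set {set 'I_n}}) : nat :=
  n - \max_(A : {set 'I_n} * {set 'I_n} | admissible_pair F A)
        (#|A.1| + #|A.2|).

Definition almost_2stable (n : nat) (A : {set 'I_n}) : bool :=
  [forall i in A, forall j in A, `|i - j|%N != 1].

Definition almost_2stable_sub (n : nat) (F : {set {set 'I_n}}) :
    {set {set 'I_n}} :=
  [set A in F | almost_2stable A].

(* Main.v *)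
Require Import Defs.
From mathcomp Require Import all_boot.
From mathcomp Require Import zify.

(* Fan's parity form of the octahedral Tucker lemma is proved by induction on
   the dimension.  Modulo 2, the boundary of the chains of sign vectors filling a
   hemisphere is the sphere one dimension below, while the coboundary of
   "alternating, starting with sign s" is "alternating, starting with s" plus
   "alternating, starting with -s"; antipodality exchanges the hemispheres.

   Given a proper colouring with k colours, and a the maximum defining cd2, a
   sign vector X is labelled +-(a + j) if its positive or negative part contains
   a member of colour j of the stable subsystem, and otherwise by the length of
   its longest alternating subsequence, signed by its last sign.  The two parts
   of an alternating subsequence are almost 2-stable, so this length is at most
   a in the second case, and Tucker's lemma gives n <= a + k. *)

Set Implicit Arguments.
Unset Strict Implicit.
Unset Printing Implicit Defensive.

(** * Sums modulo 2 *)

Notation "\xor_ ( i | P ) F" := (\big[addb/false]_(i | P%B) F)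
  (at level 41, F at level 41, i at level 50,
   format "\xor_ ( i  |  P )  F").

Lemma xor_involution (I : finType) (P F : pred I) (s : I -> I) :
    involutive s -> (forall i, P i -> [&& P (s i), s i != i & F (s i) == F i]) ->
  \xor_(i | P i) F i = false.
Proof.
move=> sK hs.
have Ps i : P (s i) = P i.
  by apply/idP/idP => /hs /and3P[] //; rewrite sK.
rewrite (bigID (fun i => enum_rank i < enum_rank (s i))) /=.
rewrite [X in _ (+) X](reindex_inj (inv_inj sK)) /=.
rewrite [X in _ (+) X](eq_big (fun i => P i && (enum_rank i < enum_rank (s i))) F).
- by rewrite addbb.
- move=> i; rewrite Ps sK; case Pi: (P i) => //=.
  have /and3P[_ ne _] := hs i Pi.
  rewrite -leqNgt leq_eqVlt; case: eqP => //= /val_inj/enum_rank_inj e.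
  by rewrite -e eqxx in ne.
- by move=> i /andP[]; rewrite Ps => /hs /and3P[_ _ /eqP].
Qed.

Lemma xor_symmetric (I : finType) (P : pred I) (Q f : rel I) :
    (forall x y, P x -> Q x y ->
       [&& P y, Q y x, x != y & f x y == f y x]) ->
  \xor_(x | P x) \xor_(y | Q x y) f x y = false.
Proof.
move=> h; rewrite pair_big_dep /=.
apply: (@xor_involution _ _ _ (fun p => (p.2, p.1))); first by case.
case=> x y /= /andP[Px Qxy]; have /and4P[-> -> ne /eqP ->] := h x y Px Qxy.
by rewrite eqxx xpair_eqE eq_sym (negbTE ne).
Qed.

(** * Alternating label sequences and their deletions *)

(** The coboundary modulo 2 of the cochain [g], evaluated at [L]. *)
Fixpoint deletions (L : seq nat) (g : seq nat -> bool) : bool :=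
  if L is x :: L' then g L' (+) deletions L' (fun M => g (x :: M)) else false.

Lemma eq_deletions L g h :
  (forall M, subseq M L -> g M = h M) -> deletions L g = deletions L h.
Proof.
elim: L g h => //= x L IH g h gh; congr (_ (+) _).
  by apply: gh; exact: subseq_cons.
by apply: IH => M sM; apply: gh; rewrite /= eqxx.
Qed.

Lemma deletions_rem L g : (forall M N, perm_eq M N -> g M = g N) ->
  deletions L g = \big[addb/false]_(x <- L) g (rem x L).
Proof.
elim: L g => [|x L IH] g gP; first by rewrite big_nil.
rewrite big_cons /= eqxx IH; last by move=> M N MN; apply: gP; rewrite perm_cons.
congr (_ (+) _); rewrite big_seq [RHS]big_seq; apply: eq_bigr => y yL.
apply: gP; case: eqP => [->|_]; last by [].
by rewrite perm_sym; exact: perm_to_rem.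
Qed.

Lemma perm_deletions L M g : (forall M N, perm_eq M N -> g M = g N) ->
  perm_eq L M -> deletions L g = deletions M g.
Proof.
move=> gP LM; rewrite !deletions_rem // (perm_big _ LM) /=.
rewrite big_seq [RHS]big_seq; apply: eq_bigr => x xM; apply: gP.
rewrite -(perm_cons x) (perm_trans _ (perm_to_rem xM)) //.
by apply: (perm_trans _ LM); rewrite perm_sym perm_to_rem // (perm_mem LM).
Qed.

Fixpoint alternating (s : bool) (L : seq nat) : bool :=
  if L is x :: L' then (odd x == s) && alternating (~~ s) L' else true.

(** Deleting the head contributes [alternating s] of the tail. If the head has sign [s], the other
    deletions turn this into [alternating (~~ s)] of the tail; otherwise they contribute nothing. *)
Lemma deletions_alternating L s :
  deletions L (alternating s) = alternating s L (+) alternating (~~ s) L.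
Proof.
elim: L s => [|x L IH] s //=.
have -> : deletions L (fun M => (odd x == s) && alternating (~~ s) M) =
          (odd x == s) && deletions L (alternating (~~ s)).
  case: (odd x == s) => //=.
  by elim: L {IH}.
rewrite IH negbK.
by case: s; case: (odd x) => //=; case: alternating => //=; case: alternating.
Qed.

(** Sorting the codes orders the labels by absolute value, whatever their order along the chain. *)
Definition fan_label s L := alternating s (sort leq L).

Lemma perm_fan_label s L M : perm_eq L M -> fan_label s L = fan_label s M.
Proof.
by move=> LM; congr alternating; apply/perm_sortP => //;
  [exact: leq_total | exact: leq_trans | exact: anti_leq].
Qed.

Lemma deletions_fan_label L s :
  deletions L (fan_label s) = fan_label s L (+) fan_label (~~ s) L.
Proof.
rewrite -deletions_alternating.
have sL : perm_eq L (sort leq L) by rewrite perm_sym perm_sort.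
rewrite (perm_deletions (@perm_fan_label s) sL).
apply: eq_deletions => M /(subseq_sorted leq_trans)/(_ (sort_sorted leq_total L)).
by rewrite /fan_label => /sorted_sort ->; last exact: leq_trans.
Qed.

(* A nonzero signed label is encoded in nat: half is its absolute value minus
   one, parity its sign. *)
Definition flip x := ~~ odd x + x./2.*2.

Lemma odd_flip x : odd (flip x) = ~~ odd x.
Proof. by rewrite /flip oddD odd_double addbF; case: (odd x). Qed.

Definition noncomplementary (L : seq nat) : Prop :=
  {in L &, forall x y, x./2 = y./2 -> x = y}.

(** Without complementary pairs [flip] is monotone on [L], so it commutes with sorting and only
    reverses the signs. *)
Lemma fan_label_flip s L : noncomplementary L ->
  fan_label s (map flip L) = fan_label (~~ s) L.
Proof.
move=> nL; rewrite /fan_label.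
have -> : sort leq (map flip L) = map flip (sort leq L).
  apply: (sorted_eq leq_trans anti_leq); first exact: sort_sorted leq_total _.
    rewrite sorted_map.
    apply: (@sub_in_sorted _ (mem L) leq) (sort_sorted leq_total L).
      move=> x y xL yL lexy /=; have := nL x y xL yL.
      by rewrite /flip; lia.
    by apply/allP => x; rewrite mem_sort.
  by rewrite perm_sort; apply: perm_map; rewrite perm_sym perm_sort.
elim: (sort _ _) s => //= x M IH s; rewrite IH odd_flip.
by case: s; case: odd.
Qed.

(** Neighbours in the sorted list have opposite signs and are not complementary, so the halves
    strictly increase below [m]. *)
Lemma fan_label_size s L m : noncomplementary L -> {in L, forall x, x < m.*2} ->
  fan_label s L -> size L <= m.
Proof.
move=> nL lL; rewrite /fan_label -(size_sort leq).
have := sort_sorted leq_total L.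
have: {subset sort leq L <= L} by move=> x; rewrite mem_sort.
move: (sort leq L) => M ML sM aM.
have sortM : sorted ltn (map half M).
  elim: M s aM sM ML => //= x [|y M] IH s //= /and3P[ox oy aM] /andP[xy pM] ML.
  apply/andP; split; last first.
    apply: (IH (~~ s)) => //=; first by rewrite oy.
    by move=> z zM; apply: ML; rewrite inE zM orbT.
  have := nL x y (ML x _) (ML y _); rewrite !inE !eqxx ?orbT => /(_ isT isT).
  by move: ox oy => /eqP ? /eqP; lia.
rewrite -(size_map half) -[m](size_iota 0); apply: uniq_leq_size.
  exact: (sorted_uniq ltn_trans ltnn sortM).
move=> _ /mapP[x /ML/lL xm ->]; rewrite mem_iota; lia.
Qed.

(** * Chains of sign vectors and the octahedral Tucker lemma *)

Section SignVectors.

Variable n : nat.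
Definition signvec := {ffun 'I_n -> option bool}.
Implicit Types (X Y : signvec) (x y : 'I_n * bool).

Definition zerov : signvec := [ffun=> None].
Definition oppv X : signvec := [ffun i => omap negb (X i)].
Definition setv X x : signvec := [ffun i => if i == x.1 then Some x.2 else X i].
Definition subv X Y := [forall i, (X i == None) || (X i == Y i)].

Lemma oppv0 : oppv zerov = zerov.
Proof. by apply/ffunP=> i; rewrite !ffunE. Qed.

Lemma oppv_setv X x : oppv (setv X x) = setv (oppv X) (x.1, ~~ x.2).
Proof. by apply/ffunP=> i; rewrite !ffunE /=; case: eqP. Qed.

Lemma setv_neq0 X x : setv X x != zerov.
Proof. by apply/eqP => /ffunP/(_ x.1); rewrite !ffunE eqxx. Qed.

Lemma setvC X x y : x.1 != y.1 -> setv (setv X x) y = setv (setv X y) x.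
Proof.
move=> ne; apply/ffunP=> i; rewrite !ffunE.
by case: (i =P x.1) => // ->; rewrite (negbTE ne).
Qed.

Lemma setv_neqNone X x i : X i != None -> setv X x i != None.
Proof. by move=> Xi; rewrite ffunE; case: ifP. Qed.

Lemma subv_trans : transitive subv.
Proof.
move=> Y X Z /forallP XY /forallP YZ; apply/forallP=> i.
by have /orP[->|/eqP ->] := XY i; last exact: YZ.
Qed.

Lemma subv_setv X x : X x.1 = None -> subv X (setv X x).
Proof.
move=> Xx; apply/forallP=> i; rewrite ffunE.
by case: ifP => [/eqP ->|_]; rewrite ?Xx ?eqxx ?orbT.
Qed.

Variable lam : signvec -> nat.

Fixpoint chain_labels X (L : seq nat) : Prop :=
  if L is l :: L' then
    exists Y, [/\ subv X Y, Y != zerov, lam Y = l & chain_labels Y L']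
  else True.

(* Parity of the ways to add [r] signed coordinates allowed by [ok] to [X], one
   at a time, so that the label sequence of the vectors met satisfies [g] and
   the last vector satisfies [h]. *)
Fixpoint walks (h : pred signvec) (ok : pred ('I_n * bool)) r X
    (g : seq nat -> bool) : bool :=
  if r is r'.+1 then
    \xor_(x | ok x && (X x.1 == None))
      walks h ok r' (setv X x) (fun L => g (lam (setv X x) :: L))
  else h X && g [::].

Implicit Types (h : pred signvec) (ok : pred ('I_n * bool)).

Lemma eq_walks h ok r X g g' :
    (forall L, chain_labels X L -> size L = r -> g L = g' L) ->
  walks h ok r X g = walks h ok r X g'.
Proof.
elim: r X g g' => [|r IH] X g g' gg' /=; first by rewrite gg'.
apply: eq_bigr => x /andP[_ /eqP Xx]; apply: IH => L cL sL.
apply: gg' => /=; last by rewrite sL.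
by exists (setv X x); rewrite setv_neq0 subv_setv.
Qed.

Lemma eq_walks_ok h ok ok' r X g :
    (forall x, X x.1 = None -> ok x = ok' x) ->
  walks h ok r X g = walks h ok' r X g.
Proof.
elim: r X g => [|r IH] X g //= okE.
apply: eq_big => [x|x _].
  by case: (X x.1 =P None) => [/okE ->|]; rewrite ?andbF.
apply: IH => y; rewrite ffunE; case: eqP => // _; exact: okE.
Qed.

Lemma eq_walks_leaf h h' ok r X g :
  h =1 h' -> walks h ok r X g = walks h' ok r X g.
Proof.
by move=> hh'; elim: r X g => [|r IH] X g /=; [rewrite hh' | apply: eq_bigr => x _].
Qed.

Lemma walks_exists h ok r X g : walks h ok r X g ->
  exists L, [/\ chain_labels X L, size L = r & g L].
Proof.
elim: r X g => [|r IH] X g /=; first by case/andP=> _ g0; exists [::].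
move=> W; have /existsP[x /and3P[_ /eqP Xx]] : [exists x, [&& ok x, X x.1 == None &
    walks h ok r (setv X x) (fun L => g (lam (setv X x) :: L))]].
  apply: contraLR W => /existsPn W; rewrite big1 // => x /andP[ox Xx].
  by have:= W x; rewrite ox Xx => /negbTE.
case/IH=> L [cL sL gL]; exists (lam (setv X x) :: L); split=> //=; last by rewrite sL.
by exists (setv X x); rewrite setv_neq0 subv_setv.
Qed.

Lemma walksD h ok r X g g' :
  walks h ok r X (fun L => g L (+) g' L) =
  walks h ok r X g (+) walks h ok r X g'.
Proof.
elim: r X g g' => [|r IH] X g g' /=; first by case: (h X).
by rewrite -big_split /=; apply: eq_bigr => x _; rewrite IH.
Qed.

(* Deleting an inner vector of a chain leaves a facet with exactly two fillings,
   so only the deletions of the last vector survive modulo 2. *)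
Lemma walks_deletions ok r X g :
  walks xpredT ok r.+1 X (deletions^~ g) =
  walks (fun Y => \xor_(x | ok x && (Y x.1 == None)) true) ok r X g.
Proof.
elim: r X g => [|r IH] X g /=.
  rewrite [RHS]andbC big_distrr /=.
  by apply: eq_bigr => x _; rewrite addbF andbT.
rewrite (eq_bigr (fun x =>
    walks xpredT ok r.+1 (setv X x) g (+)
    walks xpredT ok r.+1 (setv X x)
      (deletions^~ (fun M => g (lam (setv X x) :: M))))); last first.
  by move=> x _; rewrite -walksD.
rewrite big_split /=.
(* Without the first vector, the two orders of adding the first two coordinates give the same chain
   and cancel. *)
rewrite [X in X (+) _]xor_symmetric.
  by rewrite addFb; apply: eq_bigr => x _; rewrite -IH.
move=> x y /andP[ox Xx] /andP[oy]; rewrite !ffunE oy ox (eq_sym x.1).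
case: (y.1 =P x.1) => // /eqP ne Xy; rewrite Xx Xy setvC 1?eq_sym //= eqxx andbT.
by apply: contra ne => /eqP ->.
Qed.

Lemma walks_frozen (i : 'I_n) ok r X g :
  X i != None -> walks (fun Y => Y i == None) ok r X g = false.
Proof.
elim: r X g => [|r IH] X g Xi /=; first by rewrite (negbTE Xi).
by apply: big1 => x _; apply: IH; exact: setv_neqNone.
Qed.

Definition below k : pred ('I_n * bool) := fun x => x.1 < k.
(** The letters of the closed hemisphere in which coordinate [i] is zero or [s]; its equator uses
    the letters [below i]. *)
Definition hemisphere (i : 'I_n) s : pred ('I_n * bool) :=
  fun x => below i x || (x == (i, s)).

(** Free letters at coordinates below [i] come in pairs of opposite sign; only [(i, s)] has no
    partner. *)
Lemma xor_free_letters (i : 'I_n) s X :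
  \xor_(x | hemisphere i s x && (X x.1 == None)) true = (X i == None).
Proof.
rewrite (bigID (fun x => x.1 == i)) /=.
rewrite [X in _ (+) X](@xor_involution _ _ _ (fun x => (x.1, ~~ x.2))); last 2 first.
- by case=> j e /=; rewrite negbK.
- case=> j e /=; rewrite /hemisphere /below /= !xpair_eqE eqxx andbT.
  by case/andP=> /andP[h ->] /negbTE ji; move: h; rewrite ji !orbF => ->; case: e.
rewrite addbF; case: (boolP (X i == None)) => Xi.
  rewrite (big_pred1 (i, s)) // => -[j e] /=.
  rewrite /hemisphere /below xpair_eqE /=.
  case: (j =P i) => [->|_]; last by rewrite !andbF.
  by rewrite ltnn Xi /= !andbT.
by rewrite big_pred0 // => x; case: (x.1 =P i) => [->|_]; rewrite ?(negbTE Xi) ?andbF.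
Qed.

Lemma walks_hemisphere (i : 'I_n) s r X g : X i = None ->
  walks (fun Y => Y i == None) (hemisphere i s) r X g =
  walks xpredT (below i) r X g.
Proof.
elim: r X g => [|r IH] X g Xi /=; first by rewrite Xi.
rewrite (bigID (below i)) /= [X in _ (+) X]big1 ?addbF; last first.
  move=> x /andP[/andP[/orP[->//|/eqP -> _] _]].
  by apply: walks_frozen; rewrite ffunE eqxx.
apply: eq_big => [x|x /andP[_ xi]].
  by rewrite /hemisphere; case: below; rewrite ?andbF ?andbT.
by apply: IH; rewrite ffunE; case: eqP xi => // ->; rewrite /below ltnn.
Qed.

(** A walk that sets coordinate [i] lies in exactly one hemisphere; a walk on the equator is counted
    three times, so once modulo 2. *)
Lemma walks_split (i : 'I_n) r X g : X i = None ->
  walks xpredT (below i.+1) r X g =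
  walks xpredT (hemisphere i true) r X g (+)
  walks xpredT (hemisphere i false) r X g (+)
  walks xpredT (below i) r X g.
Proof.
elim: r X g => [|r IH] X g Xi /=; first by case: (g _).
set B := fun ok x => walks xpredT ok r (setv X x) (fun L => g (lam (setv X x) :: L)).
have split_top ok s : ok (i, s) -> 
    \xor_(x | ok x && (X x.1 == None)) B ok x =
    B ok (i, s) (+) \xor_(x | (ok x && (X x.1 == None)) && (x != (i, s))) B ok x.
  by move=> oi; rewrite (bigD1 (i, s)) //= oi Xi.
(* Once coordinate [i] is set, the letter sets offer the same free letters. *)
have top ok s : (forall x, x.1 != i -> ok x = below i x) ->
    B ok (i, s) = B (below i) (i, s).
  move=> okE; apply: eq_walks_ok => x; rewrite ffunE /=.
  by case: eqP => // /eqP /okE.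
have hemE s x : x.1 != i -> hemisphere i s x = below i x.
  by case: x => j e ne; rewrite /hemisphere xpair_eqE (negbTE ne) orbF.
have belE x : x.1 != i -> below i.+1 x = below i x.
  move=> xi; rewrite /below ltnS leq_eqVlt; case: eqP => //= /val_inj e.
  by rewrite e eqxx in xi.
rewrite (split_top (below i.+1) true); last exact: ltnSn.
rewrite (bigD1 (i, false)) /=; last by rewrite /below /= ltnSn Xi xpair_eqE andbF.
rewrite (split_top (hemisphere i true) true) ?(split_top (hemisphere i false) false);
  try by rewrite /hemisphere eqxx orbT.
rewrite !(top _ _ belE) (top _ _ (hemE true)) (top _ _ (hemE false)).
rewrite (eq_bigl (fun x => below i x && (X x.1 == None))); last first.
  case=> j e; rewrite /below !xpair_eqE ltnS leq_eqVlt -val_eqE /=.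
  by case: ltngtP; case: e; rewrite ?andbF ?andbT.
have hsum s : \xor_(x | (hemisphere i s x && (X x.1 == None)) && (x != (i, s)))
      B (hemisphere i s) x =
    \xor_(x | below i x && (X x.1 == None)) B (hemisphere i s) x.
  apply: eq_bigl => -[j e]; rewrite /hemisphere /below !xpair_eqE -val_eqE /=.
  by case: ltngtP; case: e; case: s; rewrite ?andbF ?andbT.
rewrite !hsum (eq_bigr (fun x => B (hemisphere i true) x (+)
  B (hemisphere i false) x (+) B (below i) x)); last first.
  move=> x /andP[xi _]; apply: IH; rewrite ffunE.
  by case: eqP xi => // ->; rewrite /below ltnn.
rewrite !big_split /=.
have shuffle p q u v w : p (+) (q (+) (u (+) v (+) w)) = p (+) u (+) (q (+) v) (+) w.
  by case: p; case: q; case: u; case: v; case: w.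
by rewrite shuffle.
Qed.

Lemma walks_short k r X g :
  #|[set i : 'I_n | (i < k) && (X i == None)]| < r ->
  walks xpredT (below k) r X g = false.
Proof.
elim: r X g => //= r IH X g ltr; apply: big1 => x /andP[xk Xx]; apply: IH.
rewrite -ltnS; apply: leq_trans ltr; rewrite ltnS.
rewrite [leqRHS](cardsD1 x.1) inE (xk : x.1 < k) Xx add1n ltnS.
by apply/subset_leq_card/subsetP=> i; rewrite !inE ffunE; case: ifP; rewrite ?andbF.
Qed.

Variable m : nat.
Hypothesis lam_lt : forall X, X != zerov -> lam X < m.*2.
Hypothesis lam_opp : forall X, X != zerov -> lam (oppv X) = flip (lam X).
Hypothesis lam_sub : forall X Y, X != zerov -> subv X Y ->
  (lam X)./2 = (lam Y)./2 -> lam X = lam Y.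

Lemma walks_opp ok r X g :
  walks xpredT ok r (oppv X) g =
  walks xpredT (fun x => ok (x.1, ~~ x.2)) r X (fun L => g (map flip L)).
Proof.
elim: r X g => [|r IH] X g //=.
pose sw (x : 'I_n * bool) := (x.1, ~~ x.2).
have swK : involutive sw by case=> j e; rewrite /sw /= negbK.
rewrite (reindex_inj (inv_inj swK)) /=.
apply: eq_big => x; first by rewrite ffunE; case: (X x.1).
by move=> _; rewrite -oppv_setv lam_opp ?setv_neq0 // IH.
Qed.

Lemma chain_labelsP X L : chain_labels X L ->
  {in L, forall l, exists Y, [/\ subv X Y, Y != zerov & lam Y = l]}.
Proof.
elim: L X => // l L IH X /= [Y [XY Y0 <- cL]] k.
rewrite inE => /predU1P[->|/(IH _ cL)[Z [YZ Z0 <-]]]; first by exists Y.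
by exists Z; rewrite (subv_trans XY).
Qed.

Lemma chain_labels_noncomplementary X L : chain_labels X L -> noncomplementary L.
Proof.
elim: L X => // l L IH X /= [Y [_ Y0 <- cL]] j k.
rewrite !inE => /predU1P[->|jL] /predU1P[->|kL] //.
- by case: (chain_labelsP cL kL) => Z [YZ _ <-]; exact: lam_sub.
- by case: (chain_labelsP cL jL) => Z [YZ _ <-] /esym/lam_sub ->.
- exact: (IH _ cL).
Qed.

(** The antipodal map exchanges the hemispheres and fixes [zerov]; it flips all labels of a chain,
    which reverses the starting sign. *)
Lemma walks_fan_opp (i : 'I_n) r s :
  walks xpredT (hemisphere i false) r zerov (fan_label s) =
  walks xpredT (hemisphere i true) r zerov (fan_label (~~ s)).
Proof.
rewrite -{1}oppv0 walks_opp.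
rewrite (@eq_walks_ok _ _ (hemisphere i true)); last first.
  by case=> j e _; rewrite /hemisphere /below /= !xpair_eqE; case: e.
by apply: eq_walks => L /chain_labels_noncomplementary/fan_label_flip ->.
Qed.

Lemma fan_parity k s : k <= n -> walks xpredT (below k) k zerov (fan_label s).
Proof.
elim: k => // k IH kn; pose i := Ordinal kn.
rewrite (walks_split (i := i)) ?ffunE // walks_fan_opp.
(* The equator has only [k] coordinates, too few for a walk of [k.+1] steps. *)
rewrite [X in _ (+) X]walks_short ?addbF; last first.
  have := card_ord k; rewrite -cardsT => <-; rewrite ltnS.
  pose f (j : 'I_k) : 'I_n := widen_ord (ltnW kn) j.
  apply: leq_trans (leq_imset_card f _); apply/subset_leq_card/subsetP=> j.
  rewrite inE => /andP[jk _]; apply/imsetP; exists (Ordinal jk) => //.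
  exact: val_inj.
(* Both starting signs on one hemisphere add up to the coboundary of [fan_label s], which is then
   moved to the boundary, the equator. *)
rewrite -walksD -(@eq_walks _ _ _ _ (deletions^~ (fan_label s))); last first.
  by move=> L _ _; exact: deletions_fan_label.
rewrite walks_deletions.
rewrite (_ : walks _ _ _ _ _ = walks (fun Y => Y i == None) (hemisphere i true)
  k zerov (fan_label s)); last by apply: eq_walks_leaf => Y; exact: xor_free_letters.
by rewrite walks_hemisphere ?ffunE // IH // ltnW.
Qed.

Lemma octahedral_tucker : n <= m.
Proof.
have [L [cL <- gL]] := walks_exists (fan_parity true (leqnn n)).
apply: fan_label_size gL; first exact: chain_labels_noncomplementary cL.
by move=> l /(chain_labelsP cL)[Y [_ Y0 <-]]; exact: lam_lt.
Qed.

End SignVectors.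

(** * Alternating subsequences of a sign vector *)

Section Alternation.

Variable n : nat.
Implicit Types X Y : signvec n.

Definition sign_at X k := obind (fun i => X i) (insub k).

(* The maximal length of an alternating subsequence of the nonzero entries of
   [X] at positions below [k] whose last sign is [e]. *)
Fixpoint altlen X e k : nat :=
  if k is k'.+1 then
    if sign_at X k' == Some e then (altlen X (~~ e) k').+1 else altlen X e k'
  else 0.

Lemma sign_at_ord X (i : 'I_n) : sign_at X i = X i.
Proof. by rewrite /sign_at valK. Qed.

Lemma sign_at_opp X k : sign_at (oppv X) k = omap negb (sign_at X k).
Proof. by rewrite /sign_at; case: insub => //= i; rewrite ffunE. Qed.

Lemma altlen_opp X e k : altlen (oppv X) e k = altlen X (~~ e) k.
Proof.
elim: k e => //= k IH e; rewrite sign_at_opp !IH.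
by case: (sign_at X k) => [b|] //=; case: b; case: e.
Qed.

(** Drop the last entry of a longest alternating subsequence. *)
Lemma altlen_neg X e k : altlen X e k <= (altlen X (~~ e) k).+1.
Proof.
elim: k e => //= k IH e.
have := IH e; have := IH (~~ e); rewrite negbK.
by case: (sign_at X k) => [b|] //=; case: b; case: e => /=; lia.
Qed.

Lemma altlen_sub X Y e k : subv X Y -> altlen X e k <= altlen Y e k.
Proof.
move=> /forallP XY; elim: k e => //= k IH e.
have := altlen_neg Y e k; have := IH e; have := IH (~~ e).
have : (sign_at X k == None) || (sign_at X k == sign_at Y k).
  by rewrite /sign_at; case: insub => //= i; exact: XY.
case/orP=> /eqP -> /=; first by case: eqP; lia.
by case: eqP; lia.
Qed.

(** The last nonzero entry below [k], of sign [e] say, extends every alternating subsequence ending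
    in [~~ e], so the length for [e] is larger. *)
Lemma altlen_neq X i k : X i != None -> i < k -> altlen X true k != altlen X false k.
Proof.
move=> Xi; elim: k => // k IH; rewrite ltnS leq_eqVlt /=.
have := altlen_neg X true k; have := altlen_neg X false k => /=.
case: (i =P k :> nat) => [<- h1 h2 _ | _ h1 h2 /= /IH].
  by rewrite sign_at_ord; case: (X i) Xi => //= -[] _ /=; lia.
by case: (sign_at X k) => [[]|] //=; lia.
Qed.

Definition alt X k := maxn (altlen X true k) (altlen X false k).

(* The positions where the alternation length jumps form a maximal alternating
   subsequence, so two adjacent positions in it carry opposite signs. *)
Definition jumps X e := [set i : 'I_n | (X i == Some e) && (alt X i < alt X i.+1)].

Lemma jumps_stable X e : almost_2stable (jumps X e).
Proof.
have ne (i j : 'I_n) : i \in jumps X e -> j \in jumps X e -> i.+1 <> j.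
  rewrite !inE => /andP[/eqP Xi _] /andP[/eqP Xj] + ij.
  move: Xi Xj; rewrite -!sign_at_ord -ij /alt /= => Xi Xj; rewrite Xi Xj.
  by have := altlen_neg X e i; case: e {Xi Xj} => /=; lia.
apply/forall_inP=> i iJ; apply/forall_inP=> j jJ.
have := ne i j iJ jJ; have := ne j i jJ iJ.
lia.
Qed.

(** [alt X] starts at zero and grows by at most one per position, only at nonzero entries; the jumps
    telescope. *)
Lemma card_jumps X : #|jumps X true| + #|jumps X false| = alt X n.
Proof.
have -> : #|jumps X true| + #|jumps X false| =
    \sum_(i < n) (alt X i < alt X i.+1).
  rewrite -!sum1_card big_mkcond [X in _ + X]big_mkcond -big_split /=.
  apply: eq_bigr => i _; rewrite !inE /alt /= sign_at_ord.
  by case: (X i) => [[]|] //=; rewrite ?ltnn; case: (_ < _).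
suff E k : \sum_(i < k) (alt X i < alt X i.+1) = alt X k by exact: E.
elim: k => [|k IH]; first by rewrite big_ord0.
rewrite big_ord_recr /= IH.
have := altlen_neg X true k; have := altlen_neg X false k; rewrite /alt /=.
by case: (sign_at X k) => [[]|] //=; lia.
Qed.

End Alternation.

(** * The labelling defined by a proper colouring *)

Section Labelling.

Variables (n : nat) (F : {set {set 'I_n}}) (k : nat).
Let G := almost_2stable_sub F.
Variable c : {B : {set 'I_n} | B \in G} -> 'I_k.
Hypothesis F0 : set0 \notin F.
Hypothesis c_proper : forall A B, kneser_edge A B -> c A != c B.
Implicit Types X Y : signvec n.

Definition side X e := [set i | X i == Some e].

Definition has_color X j e := [exists B, (c B == j) && (val B \subset side X e)].

Lemma side_opp X e : side (oppv X) e = side X (~~ e).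
Proof.
by apply/setP=> i; rewrite !inE ffunE; case: (X i) => [[]|] //=; case: e.
Qed.

Lemma has_color_opp X j e : has_color (oppv X) j e = has_color X j (~~ e).
Proof. by rewrite /has_color side_opp. Qed.

Lemma has_color_sub X Y j e : subv X Y -> has_color X j e -> has_color Y j e.
Proof.
move=> /forallP XY /existsP[B /andP[cB BX]]; apply/existsP; exists B; rewrite cB.
apply: subset_trans BX _; apply/subsetP=> i; rewrite !inE => /eqP Xi.
by have := XY i; rewrite Xi => /eqP <-.
Qed.

(** Members inside opposite sides are disjoint, and distinct since none is empty, so they are
    adjacent and differ in colour. *)
Lemma has_color_excl X j : has_color X j true -> ~~ has_color X j false.
Proof.
case/existsP=> A /andP[/eqP cA AX]; apply/existsP=> -[B /andP[/eqP cB BX]].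
have dAB : [disjoint val A & val B].
  rewrite disjoint_subset; apply/subsetP=> i /(subsetP AX).
  rewrite !inE => /eqP Xi; apply/negP=> /(subsetP BX); by rewrite inE Xi.
have : c A == c B by rewrite cA cB.
apply/negP/c_proper; rewrite /kneser_edge dAB andbT; apply/eqP=> AB.
move: dAB; rewrite AB -setI_eq0 setIid => /eqP B0.
by have := valP B; rewrite inE B0 (negbTE F0).
Qed.

Let a := \max_(A : {set 'I_n} * {set 'I_n} | admissible_pair F A) (#|A.1| + #|A.2|).

(** The jump sets are almost 2-stable, so a member of [F] inside one would lie in [G] and colour a
    side. Hence they form an admissible pair of total size [alt X n]. *)
Lemma alt_uncolored X : (forall j e, ~~ has_color X j e) -> alt X n <= a.
Proof.
move=> noc; rewrite -card_jumps.
pose J := (jumps X true, jumps X false).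
apply: (@leq_bigmax_cond _ (admissible_pair F)
  (fun A : {set 'I_n} * {set 'I_n} => #|A.1| + #|A.2|) J).
have sub e B : B \in F -> ~~ (B \subset jumps X e).
  move=> BF; apply/negP=> BJ.
  have BG : B \in G.
    rewrite inE BF /=; apply/forall_inP=> i iB; apply/forall_inP=> j jB.
    have /forall_inP/(_ i (subsetP BJ i iB)) := jumps_stable X e.
    by move=> /forall_inP/(_ j (subsetP BJ j jB)).
  have /negP[] := noc (c (Sub B BG)) e.
  apply/existsP; exists (Sub B BG); rewrite eqxx /=.
  by apply: (subset_trans BJ); apply/subsetP=> i; rewrite !inE => /andP[].
apply/andP; split; last by apply/forall_inP=> B BF; rewrite !sub.
rewrite disjoint_subset; apply/subsetP=> i; rewrite !inE /= => /andP[/eqP -> _].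
by [].
Qed.

(** For a nonzero vector the two lengths differ by one, so [minn] is the larger minus one, as the
    encoding requires, and the comparison gives the last sign. *)
Definition label X : nat :=
  if [pick j | has_color X j true || has_color X j false] is Some j
  then has_color X j true + (a + j).*2
  else (altlen X false n < altlen X true n) +
       (minn (altlen X true n) (altlen X false n)).*2.

Lemma altlen_neq0 X : X != zerov n -> altlen X true n != altlen X false n.
Proof.
move=> X0; have [i Xi] : exists i, X i != None; last exact: altlen_neq Xi (ltn_ord i).
apply/existsP; apply: contraNT X0 => /existsPn Xi.
by apply/eqP/ffunP=> i; rewrite ffunE; apply/eqP; rewrite -[_ == _]negbK Xi.
Qed.

Variant label_spec X : nat -> Type :=
  | Colored j of has_color X j true || has_color X j false :
      label_spec X (has_color X j true + (a + j).*2)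
  | Uncolored of (forall j e, ~~ has_color X j e) :
      label_spec X ((altlen X false n < altlen X true n) +
       (minn (altlen X true n) (altlen X false n)).*2).

Lemma labelP X : label_spec X (label X).
Proof.
rewrite /label; case: pickP => [j|noc]; first exact: Colored.
by apply: Uncolored => j e; have := noc j; case: e; case: has_color; case: has_color.
Qed.

Lemma uncolored_half X : X != zerov n -> (forall j e, ~~ has_color X j e) ->
  minn (altlen X true n) (altlen X false n) < a.
Proof. by move=> /altlen_neq0 + /alt_uncolored; rewrite /alt; lia. Qed.

Lemma label_lt X : X != zerov n -> label X < (a + k).*2.
Proof.
move=> X0; case: labelP => [j _|/(uncolored_half X0)].
  by have := ltn_ord j; case: has_color; lia.
by case: (_ < altlen _ _ _); lia.
Qed.

Lemma label_opp X : X != zerov n -> label (oppv X) = flip (label X).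
Proof.
move=> X0; rewrite /label.
(* The condition on [j] is symmetric in the two signs, so the same colour is picked for [oppv X]. *)
rewrite (eq_pick (Q := fun j => has_color X j true || has_color X j false)).
  case: pickP => [j cj|_]; rewrite /flip half_bit_double oddD odd_double addbF oddb.
    rewrite has_color_opp /=; congr (nat_of_bool _ + _).
    have := has_color_excl (X := X) (j := j).
    by move: cj; case: (has_color X j true); case: (has_color X j false) => // _ /(_ isT).
  by have := altlen_neq0 X0; rewrite !altlen_opp /=; lia.
by move=> j; rewrite !has_color_opp orbC.
Qed.

(** Halves of colour labels are at least [a], the others smaller. A coloured side of [X] stays
    coloured in [Y], whose opposite side then lacks that colour; for lengths, both values of
    [altlen] are monotone and must agree. *)
Lemma label_sub X Y : X != zerov n -> subv X Y ->
  (label X)./2 = (label Y)./2 -> label X = label Y.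
Proof.
move=> X0 XY.
have Y0 : Y != zerov n.
  apply: contraNneq X0 => Y0; apply/eqP/ffunP=> i.
  by have /forallP/(_ i) := XY; rewrite Y0 ffunE orbb => /eqP.
case: labelP => [j cj|/(uncolored_half X0) nX];
  case: labelP => [l cl|/(uncolored_half Y0) nY];
  rewrite !half_bit_double => h; try lia.
  have jl : j = l by apply: ord_inj; lia.
  rewrite {}jl in cj h *; congr (nat_of_bool _ + _).
  have := has_color_excl (X := Y) (j := l); move: cj.
  have := has_color_sub (j := l) (e := true) XY.
  have := has_color_sub (j := l) (e := false) XY.
  case: (has_color X l true) => /= [_ /(_ isT) -> //|].
  by move=> + _ cf => /(_ cf) ->; case: has_color => // /(_ isT).
have := altlen_neq0 X0; have := altlen_neq0 Y0.
have := altlen_sub true n XY; have := altlen_sub false n XY.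
have := altlen_neg X true n; have := altlen_neg X false n.
have := altlen_neg Y true n; have := altlen_neg Y false n.
by move=> /=; lia.
Qed.

Lemma colors_ge_cd2 : cd2 F <= k.
Proof.
rewrite leq_subLR.
exact: (octahedral_tucker label_lt label_opp label_sub).
Qed.

End Labelling.

Theorem theorem4p3 (n : nat) (F : {set {set 'I_n}}) (F0 : set0 \notin F) :
  cd2 F <= chromatic_number (KG2 (almost_2stable_sub F)).
Proof.
rewrite /chromatic_number; case: ex_minnP => k /existsP[c /forallP cP] _.
apply: (@colors_ge_cd2 _ _ _ c F0) => A B.
by have /forallP/(_ B)/implyP := cP A.
Qed.
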